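(* Let $N\ge1$, $s\in(0,1)$, and let $\Omega\subset\mathbb{R}^N$ be a bounded domain with $C^{0,1}$ boundary. Let $G$ be an $N$-function with $g=G'\in C^1(\mathbb{R}^+)$, and suppose there are constants $p^-,p^+$ with $1<p^--1\le\frac{t g'(t)}{g(t)}\le p^+-1<\infty$ for all $t>0$. Let $1<q\le p^-$. Then for all pairs $u,v\in W^{s,G}_0(\Omega)$ such that $u>0$ and $v>0$ a.e. in $\Omega$ and both $u/v$ and $v/u$ belong to $L^\infty(\Omega)$, $$\int_{\mathbb{R}^N}\int_{\mathbb{R}^N}g\Big(\frac{|u(x)-u(y)|}{|x-y|^s}\Big)\frac{u(x)-u(y)}{|u(x)-u(y)|}\Big(\frac{u(x)^q-v(x)^q}{u(x)^{q-1}}-\frac{u(y)^q-v(y)^q}{u(y)^{q-1}}\Big)\frac{dx\,dy}{|x-y|^{N+s}}$$ $$+\int_{\mathbb{R}^N}\int_{\mathbb{R}^N}g\Big(\frac{|v(x)-v(y)|}{|x-y|^s}\Big)\frac{v(x)-v(y)}{|v(x)-v(y)|}\Big(\frac{v(x)^q-u(x)^q}{v(x)^{q-1}}-\frac{v(y)^q-u(y)^q}{v(y)^{q-1}}\Big)\frac{dx\,dy}{|x-y|^{N+s}}\ \ge\ 0.$$ Moreover, if equality holds, then: (1) $u/v\equiv\mathrm{const}>0$ a.e. in $\Omega$; (2) if in addition $q\ne p^-$, then $u\equiv v$ a.e. in $\Omega$.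
   Context: $G:\mathbb{R}^+\to\mathbb{R}^+$ is an $N$-function if it is continuous, convex, $G(t)=0\iff t=0$, $G(t)/t\to0$ as $t\to0$ and $G(t)/t\to\infty$ as $t\to\infty$. $L^G$ is the Orlicz space of $G$. $W^{s,G}(\mathbb{R}^N)$ is the set of $u\in L^G(\mathbb{R}^N)$ such that for some $\lambda>0$, $\int_{\mathbb{R}^N}\int_{\mathbb{R}^N}G\big(\frac{|u(x)-u(y)|}{\lambda|x-y|^s}\big)\frac{dx\,dy}{|x-y|^N}<\infty$, and $W^{s,G}_0(\Omega)=\{u\in W^{s,G}(\mathbb{R}^N):u\equiv0\text{ in }\mathbb{R}^N\setminus\Omega\}$. Conventions: $g(|t|)\,t/|t|$ is understood as $0$ when $t=0$; the functions $\frac{u^q-v^q}{u^{q-1}}$ and $\frac{v^q-u^q}{v^{q-1}}$ are taken to be $0$ outside $\Omega$. *)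

(* Defs.v *)
From HB Require Import structures.
From mathcomp Require Import all_boot all_order all_algebra.
From mathcomp Require Import all_classical all_reals all_analysis.

Set Implicit Arguments.
Unset Strict Implicit.
Unset Printing Implicit Defensive.
Import Order.TTheory GRing.Theory Num.Theory.
Import numFieldNormedType.Exports.

Local Open Scope classical_set_scope.
Local Open Scope ring_scope.

(** R^n is the type 'rV[R]_n. The library gives it its topology and the
    sup-norm `|x|; the Euclidean norm is [enorm] below. Its sigma-algebra is
    the one generated by the coordinates, as for the library's n.-tuple T. *)

Fact rV_display : measure_display -> measure_display.
Proof. exact. Qed.

Section measurable_rV.
Context {d} {T : measurableType d}.
Variable n : nat.

Let coors : 'I_n -> 'rV[T]_n -> T := fun i x => x ord0 i.

Let rV_set0 : g_sigma_preimage coors set0.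
Proof. exact: sigma_algebra0. Qed.

Let rV_setC A : g_sigma_preimage coors A -> g_sigma_preimage coors (~` A).
Proof. exact: sigma_algebraC. Qed.

Let rV_bigcup (F : (set 'rV[T]_n)^nat) :
  (forall i, g_sigma_preimage coors (F i)) ->
  g_sigma_preimage coors (\bigcup_i (F i)).
Proof. exact: sigma_algebra_bigcup. Qed.

HB.instance Definition _ := @isMeasurable.Build
  (rV_display d) 'rV[T]_n (g_sigma_preimage coors)
  rV_set0 rV_setC rV_bigcup.

End measurable_rV.

Lemma measurable_coord d (T : measurableType d) n (i : 'I_n) :
  measurable_fun [set: 'rV[T]_n] (fun x : 'rV[T]_n => x ord0 i).
Proof.
move=> _ Y mY; rewrite setTI; apply: sub_sigma_algebra => /=.
rewrite -bigcup_seq/=; exists i => /=; first by rewrite mem_index_enum.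
by exists Y => //; rewrite setTI.
Qed.

Lemma measurable_fun_rV d d' (S : measurableType d) (T : measurableType d') n
    (f : S -> 'rV[T]_n) :
  (forall i, measurable_fun [set: S] (fun s => f s ord0 i)) ->
  measurable_fun [set: S] f.
Proof.
move=> mf.
have sub : g_sigma_preimage (fun i s => f s ord0 i) `<=` measurable.
  apply: smallest_sub; first exact: sigma_algebra_measurable.
  rewrite -bigcup_seq; apply: bigcup_sub => i _ A [B mB <-]; exact: mf.
rewrite (@g_sigma_preimage_comp _ _ _ _ (fun i (x : 'rV[T]_n) => x ord0 i) _ f)
  in sub.
by move=> _ A mA; apply: sub; exists A.
Qed.

Section lebesgue_rV.
Context {R : realType}.
Local Open Scope ereal_scope.

Definition rV_cons n (p : R * 'rV[R]_n) : 'rV[R]_n.+1 :=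
  \row_i (if unlift ord0 i is Some j then p.2 ord0 j else p.1).

Definition rV_uncons n (x : 'rV[R]_n.+1) : R * 'rV[R]_n :=
  (x ord0 ord0, \row_j x ord0 (lift ord0 j)).

Lemma rV_consK n : cancel (@rV_cons n) (@rV_uncons n).
Proof.
move=> [a y]; rewrite /rV_uncons /rV_cons mxE unlift_none; congr pair.
by apply/rowP => j; rewrite !mxE liftK.
Qed.

Lemma rV_unconsK n : cancel (@rV_uncons n) (@rV_cons n).
Proof.
move=> x; apply/rowP => i; rewrite mxE.
by case: unliftP => [j|] -> //=; rewrite mxE.
Qed.

Lemma measurable_rV_cons n : measurable_fun setT (@rV_cons n).
Proof.
apply: measurable_fun_rV => i; rewrite /rV_cons.
under eq_fun do rewrite mxE.
case: unliftP => [j|] _; last exact: measurable_fst.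
exact: (measurableT_comp (measurable_coord j)).
Qed.

Lemma measurable_rV_uncons n : measurable_fun setT (@rV_uncons n).
Proof.
apply/measurable_fun_pairP; split.
  exact: measurable_coord.
apply: measurable_fun_rV => i /=.
under eq_fun do rewrite mxE.
exact: measurable_coord.
Qed.

Section step.
Variables (n : nat) (mu : {sigma_finite_measure set 'rV[R]_n -> \bar R}).

Definition lebesgue_step : set 'rV[R]_n.+1 -> \bar R :=
  pushforward (@lebesgue_measure R \x mu) (@rV_cons n).

Let step0 : lebesgue_step set0 = 0.
Proof. by rewrite /lebesgue_step /pushforward preimage_set0 measure0. Qed.

Let mstep A : measurable A -> measurable (@rV_cons n @^-1` A).
Proof. by move=> mA; rewrite -[X in measurable X]setTI; exact: measurable_rV_cons. Qed.

Let step_ge0 A : 0 <= lebesgue_step A.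
Proof. by rewrite /lebesgue_step /pushforward; apply: measure_ge0. Qed.

Let step_sigma_additive : semi_sigma_additive lebesgue_step.
Proof.
move=> F mF tF mUF; rewrite /lebesgue_step /pushforward preimage_bigcup.
apply: measure_semi_sigma_additive.
- by move=> i; exact: mstep.
- apply/trivIsetP => /= i j _ _ ij; rewrite -preimage_setI.
  by move/trivIsetP : tF => /(_ _ _ _ _ ij) ->//; rewrite preimage_set0.
- by rewrite -preimage_bigcup; exact: mstep.
Qed.

HB.instance Definition _ := isMeasure.Build _ _ _ lebesgue_step
  step0 step_ge0 step_sigma_additive.

Let step_sigma_finite : sigma_finite setT lebesgue_step.
Proof.
have /sigma_finiteP[F [TF ndF Foo]] := sigma_finiteT (@lebesgue_measure R).
have /sigma_finiteP[G [TG ndG Goo]] := sigma_finiteT mu.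
exists (fun k => @rV_uncons n @^-1` (F k `*` G k)).
  rewrite -preimage_bigcup; apply/seteqP; split => // z _.
  case zE : (rV_uncons z) => [x y].
  have : setT x by []. have : setT y by [].
  rewrite {1}TF TG => -[k _ Gky] [l _ Flx].
  exists (maxn k l) => //; rewrite /preimage /mkset {}zE; split => /=.
    by move: x Flx {TF}; exact/subsetPset/ndF/leq_maxr.
  by move: y Gky; exact/subsetPset/ndG/leq_maxl.
move=> k; have [mFk Fkoo] := Foo k; have [mGk Gkoo] := Goo k; split.
  rewrite -[X in measurable X]setTI; apply: measurable_rV_uncons => //.
  exact: measurableX.
rewrite /lebesgue_step /pushforward -comp_preimage.
rewrite (_ : _ \o _ = id); last by apply/funext => p /=; rewrite rV_consK.
by rewrite preimage_id product_measure1E// lte_mul_pinfty// ge0_fin_numE.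
Qed.

HB.instance Definition _ := Measure_isSigmaFinite.Build _ _ _ lebesgue_step
  step_sigma_finite.

Definition lebesgue_succ : {sigma_finite_measure set 'rV[R]_n.+1 -> \bar R} :=
  lebesgue_step.

End step.

(** n-fold product of the one-dimensional Lebesgue measure, see
    [lebesgue_rV_prod]; R^0 is a single point of mass 1. *)
Fixpoint lebesgue_rV n : {sigma_finite_measure set 'rV[R]_n -> \bar R} :=
  if n is m.+1 then lebesgue_succ (lebesgue_rV m) else \d_ (0%R : 'rV[R]_0).

Lemma measurable_rV_prod n (A : 'I_n -> set R) :
  (forall i, measurable (A i)) ->
  measurable [set x : 'rV[R]_n | forall i, A i (x ord0 i)].
Proof.
move=> mA.
rewrite (_ : [set _ | _] =
    \big[setI/setT]_(i < n) ((fun x : 'rV[R]_n => x ord0 i) @^-1` A i)).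
  apply: bigsetI_measurable => i _.
  by rewrite -[X in measurable X]setTI; exact: measurable_coord.
rewrite -bigcap_seq; apply/seteqP; split => x /= Ax i.
  by move=> _; exact: Ax.
by apply: Ax; rewrite /= mem_index_enum.
Qed.

Lemma lebesgue_rV_prod n (A : 'I_n -> set R) :
  (forall i, measurable (A i)) ->
  lebesgue_rV n [set x : 'rV[R]_n | forall i, A i (x ord0 i)] =
  \prod_(i < n) lebesgue_measure (A i).
Proof.
elim: n A => [|n ih] A mA.
  by rewrite big_ord0 /= diracE mem_set// => -[].
rewrite big_ord_recl -(ih (fun i => A (lift ord0 i)))//.
rewrite -product_measure1E; first last.
- exact: (@measurable_rV_prod n (fun i => A (lift ord0 i))).
- exact: mA.
rewrite /= /lebesgue_step /pushforward.
congr (product_measure1 _ _ _); apply/seteqP; split => -[a y] /=; rewrite /rV_cons.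
  move=> Ax; split=> [|i]; first by have := Ax ord0; rewrite mxE unlift_none.
  by have := Ax (lift ord0 i); rewrite mxE liftK.
by move=> [Aa Ay] i; rewrite mxE; case: unliftP => [j|] ->.
Qed.

End lebesgue_rV.
Arguments lebesgue_rV : clear implicits.

Definition enorm {R : realType} n (x : 'rV[R]_n) : R :=
  Num.sqrt (\sum_i (x ord0 i) ^+ 2).

(** C^{0,1} boundary: near each boundary point, after an orthogonal change of
    coordinates y = x *m B, Omega is the region y_i > phi(the other y_j) above
    the graph of a Lipschitz function phi. *)
Definition C01_boundary {R : realType} n (Omega : set 'rV[R]_n) :=
  forall z : 'rV[R]_n, (closure Omega `\` Omega°) z ->
    exists r : R, exists B : 'M[R]_n, exists i : 'I_n,
    exists phi : 'rV[R]_n.-1 -> R^o,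
    [/\ 0 < r, B *m B^T = 1%:M, lipschitz phi &
      forall x : 'rV[R]_n, enorm (x - z) < r ->
        (Omega x <-> phi (col' i (x *m B)) < (x *m B) ord0 i)].

Record lipschitz_bounded_domain {R : realType} n (Omega : set 'rV[R]_n) :
    Prop := {
  lbd_open : open Omega ;
  lbd_connected : connected Omega ;
  lbd_nonempty : Omega !=set0 ;
  lbd_bounded : bounded_set Omega ;
  lbd_boundary : C01_boundary Omega }.

(** Functions on [0, +oo[ are represented by functions on R whose values at
    negative arguments are irrelevant. *)
Record N_function {R : realType} (G : R -> R) : Prop := {
  nfun_ge0 : forall t : R, 0 <= t -> 0 <= G t ;
  nfun_continuous : {within `[0, +oo[, continuous G} ;
  nfun_convex : convex_function (`[0, +oo[%classic : set R^o) G ;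
  nfun_eq0 : forall t : R, 0 <= t -> (G t = 0 <-> t = 0) ;
  nfun_cvg0 : G t / t @[t --> 0^'+] --> (0 : R) ;
  nfun_cvgy : G t / t @[t --> +oo] --> +oo }.

(** f' is the derivative of f on [0, +oo[, one-sided at 0. *)
Definition derivative_Rplus {R : realType} (f f' : R -> R) :=
  forall t : R, 0 <= t ->
    (f y - f t) / (y - t) @[y --> within `[0, +oo[%classic t^'] --> f' t.

Section orlicz_sobolev.
Context {R : realType} {N : nat}.
Local Notation mu := (lebesgue_rV R N).
Implicit Types (G g : R -> R) (s q : R) (u v : 'rV[R]_N -> R).
Implicit Types (Omega : set 'rV[R]_N).

Definition orlicz G u :=
  measurable_fun setT u /\
  exists2 lam : R, 0 < lam & (\int[mu]_x (G (`|u x| / lam))%:E < +oo)%E.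

Definition orlicz_sobolev s G u :=
  orlicz G u /\
  exists2 lam : R, 0 < lam &
    (\int[mu \x mu]_z
       (G (`|u z.1 - u z.2| / (lam * enorm (z.1 - z.2) `^ s))
        / enorm (z.1 - z.2) ^+ N)%:E < +oo)%E.

Definition orlicz_sobolev0 s G Omega u :=
  orlicz_sobolev s G u /\ {ae mu, forall x, ~ Omega x -> u x = 0}.

(** The test function (u^q - v^q) / u^(q-1), taken to be 0 outside Omega. *)
Definition picone_test q Omega u v : 'rV[R]_N -> R :=
  fun x => if x \in Omega
           then (u x `^ q - v x `^ q) / u x `^ (q - 1) else 0.

(** The quotient (u x - u y) / |u x - u y| is 0 when u x = u y, since division
    by 0 yields 0. *)
Definition picone_form s g u (phi : 'rV[R]_N -> R) : \bar R :=
  (\int[mu \x mu]_z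
     (g (`|u z.1 - u z.2| / enorm (z.1 - z.2) `^ s)
      * ((u z.1 - u z.2) / `|u z.1 - u z.2|)
      * (phi z.1 - phi z.2)
      / enorm (z.1 - z.2) `^ (N%:R + s))%:E)%E.

(** Membership in L^oo(Omega), through the extension by 0. *)
Definition Linfty Omega (w : 'rV[R]_N -> R) := w \_ Omega \in Lfun mu +oo%E.

End orlicz_sobolev.

(* Main.v *)
Require Import Defs.
From mathcomp Require Import all_boot all_order all_algebra.
From mathcomp Require Import all_classical all_reals all_analysis.
From mathcomp Require Import ess_sup_inf measurable_realfun ring lra.
Import Order.TTheory GRing.Theory Num.Theory.
Import numFieldNormedType.Exports.
Local Open Scope classical_set_scope.
Local Open Scope ring_scope.

(** With [h t = g t / t^(q-1)], which is nondecreasing because [q <= pm] (and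
    increasing if [q < pm]), the discrete Picone inequality bounds the two
    integrands from below by the same multiple of [h A * (A^q - C^q)] and
    [h C * (C^q - A^q)], where [A = |u x - u y| / |x - y|^s] and
    [C = |v x - v y| / |x - y|^s]; the sum [(h A - h C) * (A^q - C^q)] is
    nonnegative. Equality forces equality in Picone's inequality, that is
    [v x * u y = u x * v y] for almost all [(x, y)], and [A = C] when [q < pm];
    taking [y] outside [Omega] then gives [u x = v x]. Both forms are
    integrable by Young's inequality for [G] and the comparability of [u] and
    [v], so the two integrals may be added. *)

Set Implicit Arguments.
Unset Strict Implicit.

(** * Convexity of powers and the discrete Picone inequality *)

Section powR_convexity.
Context {R : realType}.
Implicit Types (a b c d m t q : R).

Lemma continuous_powR_ge0 q : 0 < q -> {within `[0, +oo[, continuous (@powR R ^~ q)}.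
Proof.
move=> q0; apply/continuous_within_itvcyP; split.
  move=> x; rewrite in_itv/= andbT => x0.
  apply: differentiable_continuous; apply/derivable1_diffP.
  by apply: derivable_powR; rewrite in_itv/= andbT.
by rewrite powR0 ?gt_eqF//; exact: powR_cvg0.
Qed.

Lemma continuous_powR_segment q a b : 0 < q -> 0 <= a ->
  {within `[a, b], continuous (@powR R ^~ q)}.
Proof.
move=> q0 a0; apply: continuous_subspaceW (continuous_powR_ge0 q0).
by apply: subset_itv; rewrite ?bnd_simp.
Qed.

(** Strict convexity: the mean value theorem between [m] and [t] gives a slope [q * c^(q-1)], which
    strict monotonicity compares with the slope at [m]. Derivatives are taken only at interior
    points, so [m = 0] and [t = 0] are covered. *)
Lemma powR_tangent_lt q m t : 1 < q -> 0 <= m -> 0 <= t -> t != m ->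
  m `^ q + q * m `^ (q - 1) * (t - m) < t `^ q.
Proof.
move=> q1 m0 t0 tm.
have q0 : 0 < q by lra.
have q10 : 0 < q - 1 by lra.
have mvt a b : 0 <= a -> a < b -> exists2 c, c \in `]a, b[%R &
    b `^ q - a `^ q = q * c `^ (q - 1) * (b - a).
  move=> a0 ab; apply: (@MVT _ (@powR R ^~ q) (fun c => q * c `^ (q - 1))) => //; last exact: continuous_powR_segment.
  by move=> x; rewrite in_itv/= => /andP[ax _]; apply: is_derive1_powR; lra.
case: (ltgtP t m) tm => // tm _.
  have [c] := mvt _ _ t0 tm; rewrite in_itv/= => /andP[tc cm] e.
  have : c `^ (q - 1) < m `^ (q - 1) by apply: gt0_ltr_powR => //; rewrite ?nnegrE; lra.
  rewrite -subr_gt0 => h; have : 0 < q * (m `^ (q - 1) - c `^ (q - 1)) * (m - t).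
    by rewrite !mulr_gt0// subr_gt0.
  lra.
have [c] := mvt _ _ m0 tm; rewrite in_itv/= => /andP[mc ct] e.
have : m `^ (q - 1) < c `^ (q - 1) by apply: gt0_ltr_powR => //; rewrite ?nnegrE; lra.
rewrite -subr_gt0 => h; have : 0 < q * (c `^ (q - 1) - m `^ (q - 1)) * (t - m).
  by rewrite !mulr_gt0// subr_gt0.
lra.
Qed.

(* The junk value [0 / 0 = 0] makes [b = d = 0] admissible. *)
Lemma perspective_tangent q m b d : 1 < q -> 0 <= m -> 0 <= b -> 0 <= d ->
  (b = 0 -> d = 0) ->
  q * m `^ (q - 1) * d - (q - 1) * m `^ q * b <= d `^ q / b `^ (q - 1)
  ?= iff (d == m * b).
Proof.
move=> q1 m0 b0 d0 bd.
have q0 : q != 0 by apply/eqP; lra.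
have q10 : q - 1 != 0 by apply/eqP; lra.
have [be|bn] := eqVneq b 0.
  by rewrite be bd// !mulr0 subr0 !powR0// mul0r; split; rewrite ?eqxx.
have bp : 0 < b by rewrite lt_def bn.
(* For [b > 0] both sides are [b] times those of the tangent inequality at [m], evaluated at
   [d / b]. *)
have -> : d `^ q / b `^ (q - 1) = b * (d / b) `^ q.
  have bV : b^-1 `^ q = (b `^ q)^-1 by rewrite -powR_inv1// -powRrM mulN1r powRN.
  have bq : b `^ q = b * b `^ (q - 1) by rewrite mulr_powRB1//; lra.
  rewrite powRM ?invr_ge0// bV bq.
  by field; rewrite !powR_eq0 !negb_and bn.
have -> : q * m `^ (q - 1) * d - (q - 1) * m `^ q * b =
          b * (m `^ q + q * m `^ (q - 1) * (d / b - m)).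
  have mq : m `^ q = m * m `^ (q - 1) by rewrite mulr_powRB1//; lra.
  by rewrite mq; field.
have [->|dm] := eqVneq d (m * b).
  by rewrite mulfK// subrr mulr0 addr0; split; rewrite ?eqxx.
have h : d / b != m by apply: contraNneq dm => <-; rewrite divfK.
have := powR_tangent_lt q1 m0 (divr_ge0 d0 b0) h.
by rewrite -(ltr_pM2l bp) => {}h; split; [exact: ltW|exact: lt_eqF].
Qed.

(* Tangent inequalities at slope [m = (|c - d| + d) / a] for the pairs
   [(a - b, |c - d|)] and [(b, d)] add up to the value at [(a, |c - d| + d)]. *)
Lemma discrete_picone q a b c d : 1 < q -> 0 <= b -> b < a -> 0 <= c -> 0 <= d ->
  (b = 0 -> d = 0) ->
  c `^ q / a `^ (q - 1) - d `^ q / b `^ (q - 1) <=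
    `|c - d| `^ q / (a - b) `^ (q - 1) /\
  (c `^ q / a `^ (q - 1) - d `^ q / b `^ (q - 1) =
    `|c - d| `^ q / (a - b) `^ (q - 1) -> c * b = a * d).
Proof.
move=> q1 b0 ba c0 d0 bd.
have q0 : 0 < q by lra.
have a0 : 0 < a by lra.
(* Raising [c] to [c'] makes [|c - d| = c' - d] and can only increase the term in [c]. *)
pose c' := `|c - d| + d; have cc' : c <= c' by have := ler_norm (c - d); rewrite /c'; lra.
have c'0 : 0 <= c' by rewrite /c' addr_ge0.
pose m := c' / a; have m0 : 0 <= m by rewrite divr_ge0// ltW.
have [] := @perspective_tangent q m (a - b) `|c - d| => //; [lra|lra|].
move=> t1 _.
have [t2 e2] := @perspective_tangent q m b d q1 m0 b0 d0 bd.
have [t3 /esym e3] := @perspective_tangent q m a c' q1 m0 (ltW a0) c'0 (fun e : a = 0 => ltac:(lra)).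
have c'm : c' = m * a by rewrite /m divfK ?gt_eqF.
rewrite -c'm eqxx in e3; move: e3 => /esym/eqP e3.
have pa : 0 < a `^ (q - 1) by rewrite powR_gt0.
have t4 : c `^ q / a `^ (q - 1) <= c' `^ q / a `^ (q - 1).
  by rewrite ler_pM2r ?invr_gt0// ge0_ler_powR ?nnegrE//; lra.
have s : `|c - d| = c' - d by rewrite /c'; lra.
rewrite s in t1 *.
split; first by lra.
move=> e.
(* Equality at the end forces equality in every link of the chain: in [c <= c'], and in the tangent
   inequality for [(b, d)], which gives [d = m * b]. *)
have /eqP : c `^ q = c' `^ q.
  by apply: (mulIf (invr_neq0 (lt0r_neq0 pa))); lra.
move=> /eqP/powR_injective cE; have {}cE : c = c' by apply: cE; rewrite ?nnegrE.
have : d == m * b by rewrite -e2; apply/eqP; lra.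
by move=> /eqP ->; rewrite cE c'm; ring.
Qed.

(** The perspective of the power is convex with bounded slopes on the cone [c <= M * a]. The tangent
    form at slope [z / x] is exact at [(x, z)] and lies below the function at [(y, w)], so the
    difference is at most a linear form whose coefficients are controlled by [M]; exchanging the two
    points gives the absolute value. *)
Lemma perspective_lipschitz q M a b c d : 1 < q -> 0 <= M ->
  0 <= a -> 0 <= b -> 0 <= c -> 0 <= d -> c <= M * a -> d <= M * b ->
  `|c `^ q / a `^ (q - 1) - d `^ q / b `^ (q - 1)| <=
    q * M `^ (q - 1) * `|c - d| + (q - 1) * M `^ q * `|a - b|.
Proof.
move=> q1 M0 a0 b0 c0 d0 ca db.
suff H x y z w : 0 <= x -> 0 <= y -> 0 <= z -> 0 <= w -> z <= M * x -> w <= M * y ->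
  z `^ q / x `^ (q - 1) - w `^ q / y `^ (q - 1) <=
    q * M `^ (q - 1) * `|z - w| + (q - 1) * M `^ q * `|x - y|.
  rewrite ler_norml H// andbT lerNl opprB distrC (distrC a b); exact: H.
move=> x0 y0 z0 w0 zx wy.
have q0 : 0 < q by lra.
pose m := z / x; have m0 : 0 <= m by rewrite divr_ge0.
have mM : m <= M.
  rewrite /m; have [->|xn] := eqVneq x 0; first by rewrite invr0 mulr0.
  by rewrite ler_pdivrMr// lt_def xn.
have zE : z = m * x.
  rewrite /m; have [xe|xn] := eqVneq x 0; last by rewrite divfK.
  by rewrite xe mulr0; move: zx; rewrite xe mulr0; lra.
have y0w : y = 0 -> w = 0 by move=> ye; move: wy; rewrite ye mulr0; lra.
have x0z : x = 0 -> z = 0 by move=> ye; move: zx; rewrite ye mulr0; lra.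
have [t1 _] := @perspective_tangent q m y w q1 m0 y0 w0 y0w.
have [_ /esym] := @perspective_tangent q m x z q1 m0 x0 z0 x0z.
rewrite -zE eqxx => /esym/eqP t2.
rewrite -t2.
have p1 : m `^ (q - 1) <= M `^ (q - 1) by apply: ge0_ler_powR; rewrite ?nnegrE//; lra.
have p2 : m `^ q <= M `^ q by apply: ge0_ler_powR; rewrite ?nnegrE//; lra.
have n1 : q * m `^ (q - 1) * (z - w) <= q * M `^ (q - 1) * `|z - w|.
  apply: le_trans (ler_wpM2l _ (ler_norm _)) _; first by rewrite mulr_ge0 ?powR_ge0// ltW.
  by rewrite ler_wpM2r// ler_wpM2l// ltW.
have n2 : (q - 1) * m `^ q * (y - x) <= (q - 1) * M `^ q * `|x - y|.
  rewrite distrC; apply: le_trans (ler_wpM2l _ (ler_norm _)) _; first by rewrite mulr_ge0 ?powR_ge0//; lra.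
  by rewrite ler_wpM2r// ler_wpM2l//; lra.
lra.
Qed.

End powR_convexity.

(** * Growth of an N-function and of its derivative *)

Lemma is_derive_Rplus {R : realType} (f f' : R -> R) (t : R) :
  derivative_Rplus f f' -> 0 < t -> is_derive t 1 f (f' t).
Proof.
move=> ff' t0; have h := ff' t (ltW t0).
have hc : h^-1 *: (f (h *: 1 + t) - f t) @[h --> 0^'] --> f' t.
  move=> A /h [e/= e0 eA].
  (* The radius is cut at [t] so that [y + t] stays in the half-line on which the derivative is
     defined. *)
  exists (Num.min e t) => /=; first by rewrite lt_min e0.
  move=> y /=; rewrite sub0r normrN lt_min => /andP[ye yt] y0.
  have -> : y^-1 *: (f (y *: 1 + t) - f t) = (f (y + t) - f t) / (y + t - t).
    by rewrite addrK mulrC /GRing.scale/= mulr1.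
  apply: eA => /=.
  - by rewrite opprD addrC subrK normrN.
  - by apply/eqP => e1; move/eqP: y0; lra.
  - by rewrite in_itv/= andbT; move: yt; rewrite ltr_norml; lra.
apply: DeriveDef; first by apply/cvg_ex; exists (f' t).
exact/cvg_lim.
Qed.

Section N_function_growth.
Context {R : realType}.
Variables (G g g' : R -> R) (pm pp : R).
Hypotheses (hG : N_function G) (hg : derivative_Rplus G g)
  (hg' : derivative_Rplus g g') (hpm : 1 < pm - 1)
  (hgp : forall t : R, 0 < t -> pm - 1 <= t * g' t / g t <= pp - 1).
Implicit Types (x y t p : R).

Lemma derivative_continuous_gt0 t : 0 < t -> {for t, continuous g}.
Proof.
move=> t0; apply: differentiable_continuous; apply/derivable1_diffP.
exact: (@ex_derive _ _ _ _ _ _ _ (is_derive_Rplus hg' t0)).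
Qed.

Lemma N_function_gt0 t : 0 < t -> 0 < G t.
Proof.
move=> t0; rewrite lt_def nfun_ge0 ?ltW// andbT.
by apply/eqP => /(nfun_eq0 hG (ltW t0)); lra.
Qed.

Lemma N_function_mvt x y : 0 <= x -> x < y ->
  exists2 c, c \in `]x, y[%R & G y - G x = g c * (y - x).
Proof.
move=> x0 xy; apply: (@MVT _ G g) => //.
  by move=> c; rewrite in_itv/= => /andP[xc _]; apply: is_derive_Rplus => //; lra.
apply: continuous_subspaceW (nfun_continuous hG).
by apply: subset_itv; rewrite ?bnd_simp.
Qed.

(* [g] cannot vanish because [t * g' t / 0 = 0] violates the growth bound. *)
Lemma N_function_derivative_gt0 t : 0 < t -> 0 < g t.
Proof.
move=> t0; rewrite ltNge; apply/negP => gt0.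
(* Since [G t > 0 = G 0], [g] is positive somewhere in []0, t[]; a value [g t <= 0] would then
   produce a zero of [g] at a positive point. *)
have [c] := @N_function_mvt 0 t (lexx 0) t0.
rewrite in_itv/= => /andP[c0 ct].
rewrite (nfun_eq0 hG (lexx 0)).2// !subr0 => Gc.
have gc0 : 0 < g c by rewrite -(pmulr_lgt0 _ t0) -Gc N_function_gt0.
have [| |d] := @IVT _ g c t 0 (ltW ct).
- apply: continuous_in_subspaceT => z /set_mem/=.
  by rewrite in_itv/= => /andP[cz _]; apply: derivative_continuous_gt0; lra.
- by rewrite ge_min le_max gt0 (ltW gc0) orbT.
rewrite in_itv/= => /andP[cd _] gd.
have d0 : 0 < d by lra.
have /andP[+ _] := hgp d0; rewrite gd invr0 mulr0.
by move: hpm => + ?; lra.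
Qed.

(** The derivative of [g t * t^(-p)] at [c] is [g c * c^(-p-1)] times [c * g' c / g c - p]. Since
    [K] is positive, the growth bounds alone decide the sign, in either direction according to
    [p]. *)
Lemma growth_quotient_mvt p x y : 0 < x -> x < y ->
  exists c K, [/\ 0 < c, 0 < K & g y / y `^ p - g x / x `^ p =
    (c * g' c / g c - p) * K].
Proof.
move=> x0 xy.
have dv (c : R) : 0 < c -> is_derive c 1 (fun t => g t * t `^ (- p))
    (g c * ((- p) * c `^ (- p - 1)) + c `^ (- p) * g' c).
  move=> c0; apply: is_deriveM; first exact: is_derive_Rplus.
  exact: is_derive1_powR.
have [| |c] := @MVT _ (fun t => g t * t `^ (- p))
    (fun c => g c * ((- p) * c `^ (- p - 1)) + c `^ (- p) * g' c) x y xy.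
- by move=> z; rewrite in_itv/= => /andP[xz _]; apply: dv; lra.
- apply: continuous_in_subspaceT => z /set_mem/=.
  rewrite in_itv/= => /andP[xz _]; apply: differentiable_continuous.
  apply/derivable1_diffP; apply: (@ex_derive _ _ _ _ _ _ _ (dv _ _)); lra.
rewrite in_itv/= !powRN => /andP[xc _] e.
have c0 : 0 < c by lra.
have cp : c `^ (- p - 1) = (c `^ p)^-1 / c.
  by rewrite powRB ?(gt_eqF c0) ?implybT// (powRr1 (ltW c0)) powRN.
exists c, (g c * c `^ (- p - 1) * (y - x)); split => //.
  by rewrite !mulr_gt0 ?powR_gt0 ?subr_gt0// N_function_derivative_gt0.
rewrite e cp; field.
by rewrite !gt_eqF ?powR_gt0// N_function_derivative_gt0.
Qed.

Lemma growth_quotient_le p x y : p <= pm - 1 -> 0 < x -> x <= y ->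
  g x / x `^ p <= g y / y `^ p.
Proof.
move=> ppm x0; rewrite le_eqVlt => /predU1P[->//|xy].
have [c [K [c0 K0 e]]] := growth_quotient_mvt p x0 xy.
by rewrite -subr_ge0 e mulr_ge0 ?(ltW K0)// subr_ge0; have /andP[] := hgp c0; lra.
Qed.

Lemma growth_quotient_lt p x y : p < pm - 1 -> 0 < x -> x < y ->
  g x / x `^ p < g y / y `^ p.
Proof.
move=> ppm x0 xy.
have [c [K [c0 K0 e]]] := growth_quotient_mvt p x0 xy.
by rewrite -subr_gt0 e mulr_gt0// subr_gt0; have /andP[] := hgp c0; lra.
Qed.

Lemma growth_quotient_ge p x y : pp - 1 <= p -> 0 < x -> x <= y ->
  g y / y `^ p <= g x / x `^ p.
Proof.
move=> ppm x0; rewrite le_eqVlt => /predU1P[->//|xy].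
have [c [K [c0 K0 e]]] := growth_quotient_mvt p x0 xy.
by rewrite -subr_le0 e mulr_le0_ge0 ?(ltW K0)// subr_le0; have /andP[] := hgp c0; lra.
Qed.

Lemma growth_derivative_le x y : 0 < x -> x <= y -> g x <= g y.
Proof.
move=> x0 xy; have := @growth_quotient_le 0 x y; rewrite !powRr0 !divr1; apply => //; have := hpm; lra.
Qed.

(* [g t <= k^(pp-1) * g (t/k)] and [t/k * g (t/k) <= G (2t/k) - G (t/k)]. *)
Lemma growth_mul_le lam : 0 < lam ->
  exists2 K, 0 <= K & forall t, 0 <= t -> t * g t <= K * G (t / lam).
Proof.
move=> lam0.
(* [k >= 1] gives [t / k <= t], and [k >= 2 * lam] makes the interval from [t / k] to [t / lam] at
   least [t / k] long. *)
pose k := 2 * Num.max 1 lam.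
have m1 : 1 <= Num.max 1 lam by rewrite le_max lexx.
have k2 : 2 <= k by rewrite /k; lra.
have k0 : 0 < k by lra.
have kl : 2 * lam <= k by rewrite /k ler_pM2l// le_max lexx orbT.
have K0 : 0 <= k * k `^ (pp - 1) by rewrite mulr_ge0 ?powR_ge0// ltW.
exists (k * k `^ (pp - 1)) => // t; rewrite le_eqVlt => /predU1P[<-|t0].
  by rewrite !mul0r mulr_ge0// nfun_ge0.
have tk0 : 0 < t / k by rewrite divr_gt0.
have h1 : g t <= k `^ (pp - 1) * g (t / k).
  have tkt : t / k <= t by rewrite ler_pdivrMr// ler_peMr//; lra.
  have := @growth_quotient_ge (pp - 1) (t / k) t (lexx _) tk0 tkt.
  rewrite ler_pdivrMr ?powR_gt0// => /le_trans; apply.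
  have -> : t `^ (pp - 1) = (t / k) `^ (pp - 1) * k `^ (pp - 1).
    by rewrite -powRM ?divfK ?gt_eqF// ltW.
  by rewrite mulrA divfK ?gt_eqF ?powR_gt0// mulrC.
have h2 : t / k * g (t / k) <= G (t / lam).
  have h : t / k * 2 <= t / lam.
    by rewrite mulrAC ler_pdivrMr// mulrAC ler_pdivlMr// -mulrA ler_pM2l.
  have [c] := @N_function_mvt (t / k) (t / lam) (ltW tk0) ltac:(lra).
  rewrite in_itv/= => /andP[ct _] e.
  have G0 : 0 <= G (t / k) by rewrite nfun_ge0// ltW.
  have gc : g (t / k) <= g c by apply: growth_derivative_le => //; exact: ltW.
  have g0 := N_function_derivative_gt0 tk0.
  have : g (t / k) * (t / k) <= g c * (t / lam - t / k).
    apply: ler_pM => //; [exact: ltW|exact: ltW|lra].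
  lra.
apply: le_trans (ler_wpM2l (ltW t0) h1) _.
have -> : t * (k `^ (pp - 1) * g (t / k)) = k * k `^ (pp - 1) * (t / k * g (t / k)).
  by field; rewrite gt_eqF.
by rewrite ler_wpM2l.
Qed.

(** As [g] is nondecreasing, the mixed product is at most the diagonal term of the larger of [x] and
    [y]. This form of Young's inequality avoids the complementary function. *)
Lemma growth_young x y : 0 < x -> 0 <= y -> g x * y <= x * g x + y * g y.
Proof.
move=> x0 y0.
have gx := N_function_derivative_gt0 x0.
have gy : 0 <= y * g y.
  move: y0; rewrite le_eqVlt => /predU1P[<-|y0]; first by rewrite mul0r.
  by rewrite mulr_ge0 ?ltW// N_function_derivative_gt0.
have [yx|xy] := leP y x.
  have : g x * y <= g x * x by rewrite ler_pM2l.
  lra.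
have : g x * y <= g y * y by rewrite ler_wpM2r// growth_derivative_le// ltW.
nra.
Qed.

End N_function_growth.

(** * Measurability of real functions *)

Section measurable_real.
Context {R : realType} d (T : measurableType d).

(** Inversion is continuous off 0, and the convention [0^-1 = 0] identifies it with its own
    restriction to the nonzero reals. *)
Lemma measurable_fun_inv (f : T -> R) :
  measurable_fun setT f -> measurable_fun setT (fun x => (f x)^-1).
Proof.
move=> mf; apply: (measurableT_comp _ mf).
have o0 : open [set x : R | x != 0] by exact: open_neq.
have -> : (@GRing.inv R) = (@GRing.inv R) \_ [set x : R | x != 0].
  apply/funext => x; rewrite patchE; case: ifPn => //.
  by rewrite notin_setE/= => /negP; rewrite negbK => /eqP ->; rewrite invr0.
have m0 := open_measurable o0; apply/(measurable_restrictT _ m0).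
apply: open_continuous_measurable_fun => //.
by move=> x /set_mem/= x0; exact: inv_continuous.
Qed.

(** [G] and [g] are arbitrary at negative arguments, so measurability on the whole line is available
    only after truncation. *)
Lemma measurable_restrict_gt0 (f : R -> R) :
  (forall t, 0 < t -> {for t, continuous f}) -> measurable_fun setT (f \_ `]0, +oo[).
Proof.
move=> cf; apply/(measurable_restrictT f (measurable_itv `]0, +oo[)).
apply: open_continuous_measurable_fun => // x /set_mem/=.
by rewrite in_itv/= andbT; exact: cf.
Qed.

End measurable_real.

(** * Open sets and complements of bounded sets in ['rV[R]_n] *)

Section measure_rV.
Context {R : realType} {n : nat}.
Local Notation mu := (lebesgue_rV R n).
Implicit Types (A : set 'rV[R]_n).

(** The sigma-algebra is generated by coordinates, so an open set is written as the countable union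
    of the cubes with rational centre and radius [1 / (k + 1)] that it contains. *)
Lemma open_measurable_rV A : open A -> measurable A.
Proof.
move=> oA.
pose box (p : 'rV[rat]_n * nat) : set 'rV[R]_n :=
  [set x | forall i, ball (ratr (p.1 ord0 i) : R) p.2.+1%:R^-1 (x ord0 i)].
pose F p := if `[< box p `<=` A >] then box p else set0.
have -> : A = \bigcup_p F p.
  apply/seteqP; split => [x Ax|x [p _]]; last by rewrite /F; case: asboolP => // + bx; exact.
  have : nbhs x A by exact: open_nbhs_nbhs.
  move=> /nbhs_ballP[e /= e0 eA].
  (* Two points of the same cube are each within its radius of the centre, hence the bound
     [e / 2]. *)
  have [k ke] : exists k : nat, k.+1%:R^-1 < e / 2 :> R.
    have := @near_infty_natSinv_lt R (PosNum (divr_gt0 e0 (ltr0n R 2))).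
    by move=> [k _ /(_ k (leqnn k)) /= h]; exists k.
  have k0 : 0 < k.+1%:R^-1 :> R by rewrite invr_gt0.
  have /choice[c hc] i : exists q : rat, ball (ratr q : R) k.+1%:R^-1 (x ord0 i).
    have [q] := @rat_in_itvoo R (x ord0 i) (x ord0 i + k.+1%:R^-1) ltac:(by rewrite ltrDl).
    rewrite in_itv/= => /andP[xq qx]; exists q.
    by rewrite /ball/= ltr_norml; move: k0 xq qx; set w := k.+1%:R^-1; lra.
  exists (\row_i c i, k) => //; rewrite /F.
  have bx : box (\row_i c i, k) x by move=> i /=; rewrite mxE; exact: hc.
  case: asboolP => //; apply; apply: subset_trans eA => y yb; split => // i j.
  rewrite (ord1 i); have := yb j; rewrite /= mxE => cy.
  have := ball_triangle (ball_sym (hc j)) cy.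
  by apply: le_ball; move: ke => /=; set w := k.+1%:R^-1; lra.
apply: countable_bigcupT_measurable => // p; rewrite /F.
case: asboolP => // _.
apply: (@measurable_rV_prod R n (fun i => ball (ratr (p.1 ord0 i) : R) p.2.+1%:R^-1)).
by move=> i; exact: measurable_ball.
Qed.

Lemma measurable_enorm : measurable_fun setT (@enorm R n).
Proof.
apply: (measurableT_comp (continuous_measurable_fun (@sqrt_continuous R))).
apply: measurable_sum => i; apply: measurable_funX; exact: measurable_coord.
Qed.

Lemma measurable_fun_subrV d (T : measurableType d) (f g : T -> 'rV[R]_n) :
  measurable_fun setT f -> measurable_fun setT g ->
  measurable_fun setT (fun x => f x - g x).
Proof.
move=> mf mg; apply: measurable_fun_rV => i; under eq_fun do rewrite !mxE.
by apply: measurable_funB; apply: (measurableT_comp (measurable_coord i)).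
Qed.

(** The complement contains a translate of the unit cube, far from the origin. In dimension 0 it
    could be empty. *)
Lemma bounded_setC_not_negligible A : (0 < n)%N -> bounded_set A ->
  ~ mu.-negligible (~` A).
Proof.
move=> n0 [M [_ hM]].
pose m := Num.max M 0 + 1.
have mM : M < m by rewrite /m; have : M <= Num.max M 0 by [rewrite le_max lexx]; lra.
have m0 : 0 < m by rewrite /m; have : 0 <= Num.max M 0 by [rewrite le_max lexx orbT]; lra.
pose B := [set x : 'rV[R]_n | forall i, `[m + 1, m + 2]%classic (x ord0 i)].
have BA : B `<=` ~` A.
  move=> x Bx Ax; have := hM _ mM x Ax; apply/negP; rewrite -ltNge.
  have := Bx (Ordinal n0); rewrite /= in_itv/= => /andP[h _].
  apply: (@lt_le_trans _ _ (m + 1)); first by rewrite ltrDl.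
  apply: (le_trans h); apply: (le_trans (ler_norm _)).
  rewrite -[leRHS]/(mx_norm x) mx_normrE.
  exact: (le_bigmax _ (fun ij => `|x ij.1 ij.2|) (ord0, Ordinal n0)).
have mB : measurable B by exact: (@measurable_rV_prod R n (fun=> `[m + 1, m + 2]%classic)).
have : mu B = 1%E.
  rewrite (@lebesgue_rV_prod R n (fun=> `[m + 1, m + 2]%classic))// big1// => i _.
  rewrite lebesgue_measure_itv/= lte_fin ifT; last lra.
  by rewrite -EFinB; congr EFin; ring.
move=> B1 /(negligibleS BA)/(measure_negligible mB).
by rewrite [LHS]B1 => /eqP; rewrite onee_eq0.
Qed.

End measure_rV.

(** * Almost-everywhere statements on a product space *)

Section ae_product.
Context {R : realType} d1 d2 (T1 : measurableType d1) (T2 : measurableType d2).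
Variables (m1 : {sigma_finite_measure set T1 -> \bar R})
  (m2 : {sigma_finite_measure set T2 -> \bar R}).

Lemma ae_fst (P : T1 -> Prop) : {ae m1, forall x, P x} ->
  {ae (m1 \x m2)%E, forall z, P z.1}.
Proof.
move=> [A [mA A0 PA]]; exists (A `*` setT); split; first exact: measurableX.
  (* The product vanishes even if [m2 setT] is infinite, since [0 * +oo = 0]. *)
  transitivity (m1 A * m2 setT)%E; first exact: product_measure1E.
  by rewrite A0 mul0e.
by move=> z /= Pz; split => //; exact: PA.
Qed.

Lemma ae_snd (P : T2 -> Prop) : {ae m2, forall x, P x} ->
  {ae (m1 \x m2)%E, forall z, P z.2}.
Proof.
move=> [A [mA A0 PA]]; exists (setT `*` A); split; first exact: measurableX.
  transitivity (m1 setT * m2 A)%E; first exact: product_measure1E.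
  by rewrite A0 mule0.
by move=> z /= Pz; split => //; exact: PA.
Qed.

(** The product measure of [A] is by definition the integral of the measures of its sections; when
    it is zero, almost every section is null. *)
Lemma ae_sections (P : T1 * T2 -> Prop) : {ae (m1 \x m2)%E, forall z, P z} ->
  {ae m1, forall x, {ae m2, forall y, P (x, y)}}.
Proof.
move=> [A [mA A0 PA]].
have mx : measurable_fun setT (m2 \o xsection A) by exact: measurable_fun_xsection.
have : (\int[m1]_x `|(m2 \o xsection A) x| = 0)%E.
  by under eq_integral do rewrite gee0_abs//.
move=> /(ae_eq_integral_abs m1 measurableT mx); apply: filterS => x /(_ I) xA0.
exists (xsection A x); split => //; first exact: measurable_xsection.
by move=> y Py; rewrite /xsection/= inE; exact: PA.
Qed.

End ae_product.

(** * Pointwise bounds on the Picone integrand *)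

Definition picone_value {R : realType} (q a c : R) : R :=
  (a `^ q - c `^ q) / a `^ (q - 1).

(** The function [h] of the overview. It vanishes at 0 whatever [g 0] is, because the denominator
    does. *)
Definition growth_quotient {R : realType} (g : R -> R) (q t : R) : R :=
  g t / t `^ (q - 1).

(** Here [a, b] are the values of [u] at two points, [c, d] those of [v], and [r] is the distance to
    the power [s]; the weight of the double integral is left out. *)
Definition picone_flux {R : realType} (g : R -> R) (q r a b c d : R) : R :=
  g (`|a - b| / r) * ((a - b) / `|a - b|) * (picone_value q a c - picone_value q b d).

Section pointwise.
Context {R : realType}.
Variables (G g g' : R -> R) (pm pp q : R).
Hypotheses (hG : N_function G) (hg : derivative_Rplus G g)
  (hg' : derivative_Rplus g g') (hpm : 1 < pm - 1)
  (hgp : forall t : R, 0 < t -> pm - 1 <= t * g' t / g t <= pp - 1)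
  (q1 : 1 < q) (qpm : q <= pm).
Implicit Types (a b c d r x y t M : R).

Let g_gt0 t : 0 < t -> 0 < g t.
Proof. exact: (N_function_derivative_gt0 hG hg hg' hpm hgp). Qed.

Lemma picone_valueE a c : 0 <= a -> picone_value q a c = a - c `^ q / a `^ (q - 1).
Proof.
move=> a0; rewrite /picone_value mulrBl; congr (_ - _).
have [->|an] := eqVneq a 0; first by rewrite !powR0 ?mul0r//; apply/eqP; have := q1; lra.
rewrite -(@mulr_powRB1 _ a q)//; last by have := q1; lra.
by rewrite mulfK// powR_eq0 negb_and an.
Qed.

Lemma picone_flux_swap r a b c d :
  picone_flux g q r a b c d = picone_flux g q r b a d c.
Proof. by rewrite /picone_flux distrC -(opprB b a) -(opprB (picone_value q b d)); ring. Qed.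

Local Notation h := (growth_quotient g q).

Let q0 : 0 < q. Proof. by have := q1; lra. Qed.
Let q10 : 0 < q - 1. Proof. by have := q1; lra. Qed.

Let h0 : h 0 = 0.
Proof. by rewrite /growth_quotient powR0 ?invr0 ?mulr0// gt_eqF. Qed.

Let h_gt0 t : 0 < t -> 0 < h t.
Proof. by move=> t0; rewrite /growth_quotient divr_gt0 ?powR_gt0// g_gt0. Qed.

Let h_le x y : 0 <= x -> x <= y -> h x <= h y.
Proof.
rewrite le_eqVlt => /predU1P[<-|x0 xy]; last first.
  by apply: (growth_quotient_le hG hg hg' hpm hgp) => //; have := qpm; lra.
rewrite h0 le_eqVlt => /predU1P[<-|y0]; first by rewrite h0.
by rewrite ltW// h_gt0.
Qed.

Let h_lt x y : q < pm -> 0 <= x -> x < y -> h x < h y.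
Proof.
move=> qpm'; rewrite le_eqVlt => /predU1P[<- y0|x0 xy]; first by rewrite h0 h_gt0.
by apply: (growth_quotient_lt hG hg hg' hpm hgp) => //; lra.
Qed.

Let hpow_ge0 x y : 0 <= x -> 0 <= y -> 0 <= (h x - h y) * (x `^ q - y `^ q).
Proof.
wlog xy : x y / x <= y => [H x0 y0|x0 y0].
  have [xy|/ltW yx] := leP x y; first exact: H.
  by rewrite -mulrNN !opprB; apply: H.
rewrite mulr_le0// subr_le0; first exact: h_le.
by apply: ge0_ler_powR; rewrite ?nnegrE// ltW.
Qed.

Let hpow_eq0 x y : q < pm -> 0 <= x -> 0 <= y ->
  (h x - h y) * (x `^ q - y `^ q) = 0 -> x = y.
Proof.
move=> qpm' x0 y0 /eqP; rewrite mulf_eq0 !subr_eq0 => /orP[]/eqP e; last first.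
  by apply: (powR_injective q0); rewrite ?nnegrE.
by case: (ltgtP x y) => // [/(h_lt qpm' x0)|/(h_lt qpm' y0)]; rewrite e ltxx.
Qed.

(** By the swap symmetry one may take [b <= a]. If [b < a], this is [discrete_picone] multiplied by
    [g al > 0], after the powers of [r] cancel. If [a = b] both sides are 0, so equality carries no
    information, whence the guard [a != b]. *)
Lemma picone_flux_ge r a b c d : 0 < r -> 0 <= a -> 0 <= b -> 0 <= c -> 0 <= d ->
  (a = 0 -> c = 0) -> (b = 0 -> d = 0) ->
  let al := `|a - b| / r in let ga := `|c - d| / r in
  r * (h al * (al `^ q - ga `^ q)) <= picone_flux g q r a b c d /\
  (r * (h al * (al `^ q - ga `^ q)) = picone_flux g q r a b c d ->
    a != b -> c * b = a * d).
Proof.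
move=> r0; wlog ba : a b c d / b <= a => [H|] a0 b0 c0 d0 ac bd al ga.
  have [ba|/ltW ab] := leP b a; first exact: H.
  rewrite picone_flux_swap /al /ga (distrC a) (distrC c).
  have [h1 h2] := H b a d c ab b0 a0 d0 c0 bd ac; split => // e abn.
  by have := h2 e; rewrite eq_sym abn => /(_ isT); lra.
have [e|abn] := eqVneq a b.
  by rewrite /picone_flux /al e subrr normr0 !mul0r h0 !(mul0r, mulr0).
have {abn}ba : b < a by rewrite lt_def abn.
have A0 : 0 < a - b by rewrite subr_gt0.
have nA : `|a - b| = a - b by rewrite gtr0_norm.
have al0 : 0 < al by rewrite /al nA divr_gt0.
have [p1 p2] := @discrete_picone _ q a b c d q1 b0 ba c0 d0 bd.
have -> : picone_flux g q r a b c d =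
    g al * ((a - b) - (c `^ q / a `^ (q - 1) - d `^ q / b `^ (q - 1))).
  rewrite /picone_flux !picone_valueE// -/al nA divff ?gt_eqF//; ring.
have -> : r * (h al * (al `^ q - ga `^ q)) =
    g al * ((a - b) - `|c - d| `^ q / (a - b) `^ (q - 1)).
  have divp x p : 0 <= x -> (x / r) `^ p = x `^ p / r `^ p.
    move=> x0; rewrite powRM ?invr_ge0 ?(ltW r0)//; congr (_ * _).
    by rewrite -powR_inv1 ?(ltW r0)// -powRrM mulN1r powRN.
  rewrite /growth_quotient /ga /al nA !divp ?(ltW A0)//.
  have -> : (a - b) `^ q = (a - b) * (a - b) `^ (q - 1) by rewrite mulr_powRB1// ltW.
  have -> : r `^ q = r * r `^ (q - 1) by rewrite mulr_powRB1// ltW.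
  by field; rewrite !gt_eqF ?powR_gt0.
have ga0 := g_gt0 al0.
split; first by rewrite ler_pM2l//; lra.
move=> /(mulfI (lt0r_neq0 ga0)) e _; apply: p2; lra.
Qed.

Lemma picone_flux_add_ge0 r a b c d : 0 < r ->
  0 <= a -> 0 <= b -> 0 <= c -> 0 <= d ->
  (a = 0 <-> c = 0) -> (b = 0 <-> d = 0) ->
  [/\ 0 <= picone_flux g q r a b c d + picone_flux g q r c d a b,
    picone_flux g q r a b c d + picone_flux g q r c d a b = 0 -> c * b = a * d &
    q < pm -> picone_flux g q r a b c d + picone_flux g q r c d a b = 0 ->
      `|a - b| = `|c - d|].
Proof.
move=> r0 a0 b0 c0 d0 [ac ca] [bd db].
have [s1 e1] := picone_flux_ge r0 a0 b0 c0 d0 ac bd.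
have [s2 e2] := picone_flux_ge r0 c0 d0 a0 b0 ca db.
move: s1 e1 s2 e2; set al := `|a - b| / r; set ga := `|c - d| / r.
move=> s1 e1 s2 e2.
have al0 : 0 <= al by rewrite divr_ge0// ltW.
have ga0 : 0 <= ga by rewrite divr_ge0// ltW.
have s12 : r * (h al * (al `^ q - ga `^ q)) + r * (h ga * (ga `^ q - al `^ q)) =
  r * ((h al - h ga) * (al `^ q - ga `^ q)) by ring.
have s0 : 0 <= r * ((h al - h ga) * (al `^ q - ga `^ q)).
  by rewrite mulr_ge0 ?(ltW r0)// hpow_ge0.
split; first lra.
  (* A zero sum makes both lower bounds equalities. Whichever of the pairs [(a, b)] and [(c, d)] is
     not constant supplies the identity; if both are constant it is trivial. *)
  move=> t0; have [ab|ab] := eqVneq a b; last by apply: e1 => //; lra.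
  have [cd|cd] := eqVneq c d; last by rewrite -e2//; lra.
  by rewrite ab cd mulrC.
move=> qpm' t0.
have /eqP : r * ((h al - h ga) * (al `^ q - ga `^ q)) = 0 by lra.
rewrite mulf_eq0 gt_eqF//= => /eqP/(hpow_eq0 qpm' al0 ga0).
by move=> /(mulIf (invr_neq0 (lt0r_neq0 r0))).
Qed.

(** [perspective_lipschitz] bounds the difference of test values linearly in [|a - b|] and
    [|c - d|], [growth_young] separates the product with [g al], and [growth_mul_le] passes to [G]
    at the scales [lu] and [lv]. *)
Lemma picone_flux_bound M lu lv : 0 <= M -> 0 < lu -> 0 < lv ->
  exists Ku Kv, forall r a b c d, 0 < r ->
    0 <= a -> 0 <= b -> 0 <= c -> 0 <= d -> c <= M * a -> d <= M * b ->
    `|picone_flux g q r a b c d| <=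
      r * (Ku * G (`|a - b| / r / lu) + Kv * G (`|c - d| / r / lv)).
Proof.
move=> M0 lu0 lv0.
have [Ku Ku0 hKu] := growth_mul_le hG hg hg' hpm hgp lu0.
have [Kv Kv0 hKv] := growth_mul_le hG hg hg' hpm hgp lv0.
(* [K] dominates both the coefficient [1 + (q-1) * M^q] of [|a - b|] and the coefficient
   [q * M^(q-1)] of [|c - d|]. *)
pose K := 1 + q * M `^ (q - 1) + (q - 1) * M `^ q.
have k1 : 0 <= q * M `^ (q - 1) by rewrite mulr_ge0 ?powR_ge0// ltW.
have k2 : 0 <= (q - 1) * M `^ q by rewrite mulr_ge0 ?powR_ge0// ltW.
have K0 : 0 <= K by rewrite /K; lra.
(* The factor 2 arises because [al * g al] occurs once directly and once through Young's
   inequality. *)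
exists (K * (2 * Ku)), (K * Kv) => r a b c d r0 a0 b0 c0 d0 ca db.
set al := `|a - b| / r; set ga := `|c - d| / r.
have al0 : 0 <= al by rewrite divr_ge0// ltW.
have ga0 : 0 <= ga by rewrite divr_ge0// ltW.
have Ga : 0 <= G (al / lu) by rewrite nfun_ge0// divr_ge0// ltW.
have Gg : 0 <= G (ga / lv) by rewrite nfun_ge0// divr_ge0// ltW.
have hu := hKu al al0; have hv := hKv ga ga0.
have rhs : r * (K * (2 * Ku) * G (al / lu) + K * Kv * G (ga / lv)) =
  r * K * (2 * (Ku * G (al / lu)) + Kv * G (ga / lv)) by ring.
rewrite {}rhs.
have [e|abn] := eqVneq a b.
  rewrite /picone_flux e subrr !(mul0r, mulr0) normr0.
  by rewrite mulr_ge0 ?addr_ge0 ?mulr_ge0 ?(ltW r0).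
have A0 : 0 < `|a - b| by rewrite normr_gt0 subr_eq0.
have {}al0 : 0 < al by rewrite divr_gt0.
have gal := g_gt0 al0.
have yo := growth_young hG hg hg' hpm hgp al0 ga0.
apply: (@le_trans _ _ (r * K * (g al * al + g al * ga))); last first.
  rewrite ler_wpM2l ?mulr_ge0 ?(ltW r0)//; lra.
have -> : r * K * (g al * al + g al * ga) = g al * (K * (`|a - b| + `|c - d|)).
  by rewrite /al /ga; field; rewrite gt_eqF.
rewrite /picone_flux -/al !normrM normfV normr_id divff ?gt_eqF// mulr1.
rewrite (gtr0_norm gal) ler_pM2l// !picone_valueE//.
have pl := perspective_lipschitz q1 M0 a0 b0 c0 d0 ca db.
have -> x y z w : (x - y) - (z - w) = (x - z) - (y - w) by ring.
apply: (le_trans (ler_normB _ _)); apply: (le_trans (lerD (lexx _) pl)).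
have n1 : 0 <= q * M `^ (q - 1) * `|a - b| by rewrite mulr_ge0.
have n2 : 0 <= (q - 1) * M `^ q * `|c - d| by rewrite mulr_ge0.
have n3 : 0 <= `|c - d| by [].
rewrite /K; lra.
Qed.

End pointwise.

(** * Integrals under almost-everywhere bounds *)

Section ae_integral.
Local Open Scope ereal_scope.
Context {R : realType} d (T : measurableType d).
Variable m : {measure set T -> \bar R}.
Implicit Types f g : T -> \bar R.

Lemma ae_le_integrable f g : measurable_fun setT f -> m.-integrable setT g ->
  {ae m, forall x, `|f x| <= `|g x|} -> m.-integrable setT f.
Proof.
move=> mf /integrableP[mg goo] fg; apply/integrableP; split => //.
apply: le_lt_trans goo; apply: ae_ge0_le_integral => //.
- exact: measurableT_comp.
- exact: measurableT_comp.
- by apply: filterS fg => x.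
Qed.

Lemma ae_ge0_integral f : measurable_fun setT f -> {ae m, forall x, 0 <= f x} ->
  0 <= \int[m]_x f x /\ (\int[m]_x f x = 0 -> {ae m, forall x, f x = 0}).
Proof.
move=> mf f0.
have -> : \int[m]_x f x = \int[m]_x `|f x|.
  apply: ae_eq_integral => //; first exact: measurableT_comp.
  by apply: filterS f0 => x fx _; rewrite gee0_abs.
split; first exact: integral_ge0.
move=> /(ae_eq_integral_abs m measurableT mf).
by apply: filterS => x /(_ I).
Qed.

Lemma ae_exists_in (A : set T) (P : T -> Prop) : ~ m.-negligible A ->
  {ae m, forall x, P x} -> exists2 x, A x & P x.
Proof.
move=> nA aP; apply: contrapT => nex; apply: nA; apply: negligibleS aP.
by move=> x Ax Px; apply: nex; exists x.
Qed.

End ae_integral.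

(** * Comparable pairs and measurability of the integrands *)

Section picone_integrals.
Context {R : realType} {N : nat}.
Local Notation mu := (lebesgue_rV R N).
Implicit Types (Omega : set 'rV[R]_N) (u v w phi : 'rV[R]_N -> R).

(** The norm at exponent [+oo] is an essential supremum only on a space of positive measure; [mu0]
    selects that case. *)
Lemma Linfty_ae_bounded Omega w : (0 < mu setT)%E -> Linfty Omega w ->
  exists M, {ae mu, forall x, Omega x -> `|w x| <= M}.
Proof.
move=> mu0 /sub_Lfun_finLfun; rewrite inE/= /finite_norm unlock mu0.
move=> /(@ess_supr_bounded _ _ _ mu (Num.norm \o (w \_ Omega)))[M hM]; exists M.
by apply: filterS hM => x /= + Ox; rewrite patchE mem_set.
Qed.

(** The last clause concerns [u] alone, because the two comparisons transfer it to [v]; the relation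
    is thus symmetric. *)
Definition picone_comparable M Omega u v x :=
  [/\ 0 <= u x, 0 <= v x, u x <= M * v x, v x <= M * u x &
      (Omega x -> 0 < u x) /\ (~ Omega x -> u x = 0)].

Lemma picone_comparable_sym M Omega u v x :
  picone_comparable M Omega u v x -> picone_comparable M Omega v u x.
Proof.
move=> [u0 v0 uv vu [Ou nOu]]; split => //; split => [Ox|nOx].
  rewrite lt_def v0 andbT; apply: contraTneq uv => ->.
  by rewrite mulr0 -ltNge Ou.
by apply: le_anti; rewrite v0 andbT (le_trans vu)// nOu// mulr0.
Qed.

Lemma picone_comparable_eq0 M Omega u v x :
  picone_comparable M Omega u v x -> u x = 0 <-> v x = 0.
Proof.
move=> [u0 v0 uv vu _]; split => e.
  by apply: le_anti; rewrite v0 andbT (le_trans vu)// e mulr0.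
by apply: le_anti; rewrite u0 andbT (le_trans uv)// e mulr0.
Qed.

(** Outside [Omega] both functions vanish and the quotient is [0 / 0 = 0], which agrees with the
    extension by 0. From here on the test function needs no case distinction. *)
Lemma picone_testE M Omega q u v x : picone_comparable M Omega u v x ->
  picone_test q Omega u v x = picone_value q (u x) (v x).
Proof.
move=> cx; have [_ _ _ _ [_ u0]] := cx; rewrite /picone_test; case: ifPn => // /negP.
rewrite inE => nOx; have ux := u0 nOx.
by rewrite /picone_value ((picone_comparable_eq0 cx).1 ux) ux subrr mul0r.
Qed.

Lemma measurable_picone_test Omega q u v : measurable Omega ->
  measurable_fun setT u -> measurable_fun setT v ->
  measurable_fun setT (picone_test q Omega u v).
Proof.
move=> mO mfu mfv.
have mpow w p : measurable_fun setT w -> measurable_fun setT (fun x => w x `^ p).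
  by move=> mw; exact: (measurableT_comp (measurable_powR p) mw).
apply/(measurable_restrictT (fun x => picone_value q (u x) (v x)) mO).
apply: measurable_funTS; apply: measurable_funM; last by apply: measurable_fun_inv; exact: mpow.
by apply: measurable_funB; exact: mpow.
Qed.

Definition picone_integrand s (g : R -> R) u phi (z : 'rV[R]_N * 'rV[R]_N) : R :=
  g (`|u z.1 - u z.2| / enorm (z.1 - z.2) `^ s)
  * ((u z.1 - u z.2) / `|u z.1 - u z.2|) * (phi z.1 - phi z.2)
  / enorm (z.1 - z.2) `^ (N%:R + s).

Definition orlicz_integrand s (G : R -> R) u lam (z : 'rV[R]_N * 'rV[R]_N) : R :=
  G (`|u z.1 - u z.2| / (lam * enorm (z.1 - z.2) `^ s)) / enorm (z.1 - z.2) ^+ N.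

Lemma enorm_ge0 (x : 'rV[R]_N) : 0 <= enorm x.
Proof. exact: sqrtr_ge0. Qed.

Lemma enorm_eq0 (x : 'rV[R]_N) : enorm x = 0 -> x = 0.
Proof.
move=> /eqP; rewrite sqrtr_eq0 => x0; apply/rowP => i; rewrite mxE.
have /eqP : \sum_i (x ord0 i) ^+ 2 = 0.
  by apply: le_anti; rewrite x0 sumr_ge0// => j _; rewrite sqr_ge0.
rewrite psumr_eq0 => [/allP/(_ i)|j _]; last exact: sqr_ge0.
by rewrite mem_index_enum => /(_ isT); rewrite /= sqrf_eq0 => /eqP.
Qed.

Let measurable_dist : measurable_fun setT
  (fun z : 'rV[R]_N * 'rV[R]_N => enorm (z.1 - z.2)).
Proof. exact: (measurableT_comp measurable_enorm (measurable_fun_subrV measurable_fst measurable_snd)). Qed.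

Let measurable_diff w : measurable_fun setT w ->
  measurable_fun setT (fun z : 'rV[R]_N * 'rV[R]_N => w z.1 - w z.2).
Proof.
by move=> mw; apply: measurable_funB; apply: (measurableT_comp mw);
  [exact: measurable_fst|exact: measurable_snd].
Qed.

Lemma measurable_picone_integrand (s : R) (g : R -> R) u phi : 0 < s ->
  (forall t : R, 0 < t -> {for t, continuous g}) ->
  measurable_fun setT u -> measurable_fun setT phi ->
  measurable_fun setT (picone_integrand s g u phi).
Proof.
move=> s0 cg mfu mphi.
(* Truncating [g] changes nothing: where its argument is 0, either [u z.1 = u z.2] or the distance
   is 0, and another factor vanishes. *)
have -> : picone_integrand s g u phi = picone_integrand s (g \_ `]0, +oo[) u phi.
  apply/funext => z; rewrite /picone_integrand.
  have [->|un] := eqVneq (u z.1) (u z.2); first by rewrite subrr !(mul0r, mulr0).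
  have [->|en] := eqVneq (enorm (z.1 - z.2)) 0.
    by rewrite (@powR0 _ (N%:R + s)) ?invr0 ?mulr0// gt_eqF// ltr_wpDl.
  congr (_ * _ * _ / _); rewrite patchE mem_set//= in_itv/= andbT.
  by rewrite divr_gt0 ?normr_gt0 ?subr_eq0// powR_gt0// lt_def en enorm_ge0.
have mdist p : measurable_fun setT
    (fun z : 'rV[R]_N * 'rV[R]_N => (enorm (z.1 - z.2) `^ p)^-1).
  exact: measurable_fun_inv (measurableT_comp (measurable_powR p) measurable_dist).
have mdu := measurable_diff mfu.
have mnu : measurable_fun setT (fun z : 'rV[R]_N * 'rV[R]_N => `|u z.1 - u z.2|).
  exact: measurableT_comp.
apply: measurable_funM => //; apply: measurable_funM; last exact: measurable_diff.
apply: measurable_funM; last by apply: measurable_funM => //; exact: measurable_fun_inv.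
apply: (measurableT_comp (measurable_restrict_gt0 cg)).
exact: measurable_funM.
Qed.

Lemma measurable_orlicz_integrand (s : R) (G : R -> R) u (lam : R) : 0 < lam -> G 0 = 0 ->
  (forall t : R, 0 < t -> {for t, continuous G}) ->
  measurable_fun setT u -> measurable_fun setT (orlicz_integrand s G u lam).
Proof.
move=> lam0 G0 cG mfu.
(* The argument of [G] is nonnegative and [G 0 = 0], so truncation is harmless. *)
have -> : orlicz_integrand s G u lam = orlicz_integrand s (G \_ `]0, +oo[) u lam.
  apply/funext => z; rewrite /orlicz_integrand; congr (_ / _).
  rewrite patchE; case: ifPn => //; rewrite notin_setE/= in_itv/= andbT => /negP.
  rewrite -leNgt => t0; rewrite -[RHS]G0; congr G; apply: le_anti.
  by rewrite t0 divr_ge0// mulr_ge0 ?powR_ge0// ltW.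
have mnu : measurable_fun setT (fun z : 'rV[R]_N * 'rV[R]_N => `|u z.1 - u z.2|).
  by apply: measurableT_comp => //; exact: measurable_diff.
apply: measurable_funM; last by apply: measurable_fun_inv; exact: measurable_funX.
apply: (measurableT_comp (measurable_restrict_gt0 cG)).
apply: measurable_funM => //; apply: measurable_fun_inv; apply: measurable_funM => //.
exact: (measurableT_comp (measurable_powR s) measurable_dist).
Qed.

End picone_integrals.

(** * Integrability and sign of the Picone integrands *)

Section picone_form_analysis.
Context {R : realType} {N : nat}.
Local Notation mu := (lebesgue_rV R N).
Variables (s M q pm pp : R) (Omega : set 'rV[R]_N) (G g g' : R -> R).
Hypotheses (hG : N_function G) (hg : derivative_Rplus G g)
  (hg' : derivative_Rplus g g') (hpm : 1 < pm - 1)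
  (hgp : forall t : R, 0 < t -> pm - 1 <= t * g' t / g t <= pp - 1)
  (q1 : 1 < q) (qpm : q <= pm) (s0 : 0 < s) (mOmega : measurable Omega).
Implicit Types (u v : 'rV[R]_N -> R).

Local Notation comparable := (picone_comparable M Omega).

Lemma picone_integrand_flux u v z : comparable u v z.1 -> comparable u v z.2 ->
  picone_integrand s g u (picone_test q Omega u v) z =
  picone_flux g q (enorm (z.1 - z.2) `^ s) (u z.1) (u z.2) (v z.1) (v z.2)
    / enorm (z.1 - z.2) `^ (N%:R + s).
Proof. by move=> c1 c2; rewrite /picone_integrand /picone_flux !(picone_testE (M := M)). Qed.

Lemma picone_integrand_bound lu lv : 0 < lu -> 0 < lv ->
  exists Ku Kv, forall u v z, comparable u v z.1 -> comparable u v z.2 ->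
    `|picone_integrand s g u (picone_test q Omega u v) z| <=
      Ku * orlicz_integrand s G u lu z + Kv * orlicz_integrand s G v lv z.
Proof.
move=> lu0 lv0.
(* The sign of [M] is not prescribed, whereas the flux bound asks for a nonnegative constant. *)
have M0 : 0 <= Num.max 0 M by rewrite le_max lexx.
have [Ku [Kv KB]] := picone_flux_bound hG hg hg' hpm hgp q1 M0 lu0 lv0.
have G0 : G 0 = 0 by exact/(nfun_eq0 hG).
exists Ku, Kv => u v z c1 c2.
have [e0|e0] := eqVneq (enorm (z.1 - z.2)) 0.
  have /eqP := enorm_eq0 e0; rewrite subr_eq0 => /eqP zz.
  rewrite /picone_integrand /orlicz_integrand zz !subrr normr0 !mul0r G0.
  by rewrite !(mul0r, mulr0) addr0 normr0.
have ep : 0 < enorm (z.1 - z.2) by rewrite lt_def e0 enorm_ge0.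
rewrite picone_integrand_flux//; set r := _ `^ s.
have r0 : 0 < r by exact: powR_gt0.
(* The factor [r] split off here cancels the one in the flux bound, leaving exactly the weight of
   the Orlicz integrand. *)
have -> : enorm (z.1 - z.2) `^ (N%:R + s) = enorm (z.1 - z.2) ^+ N * r.
  by rewrite powRD ?(negbTE e0) ?implybT// powR_mulrn// enorm_ge0.
have eN0 : 0 < enorm (z.1 - z.2) ^+ N by exact: exprn_gt0.
have [u1 v1 _ vu1 _] := c1; have [u2 v2 _ vu2 _] := c2.
have wM x y : 0 <= y -> x <= M * y -> x <= Num.max 0 M * y.
  by move=> y0 /le_trans; apply; rewrite ler_wpM2r// le_max lexx orbT.
have := KB r _ _ _ _ r0 u1 u2 v1 v2 (wM _ _ u1 vu1) (wM _ _ u2 vu2).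
move: (picone_flux _ _ _ _ _ _ _) => F FB.
rewrite normrM normfV (gtr0_norm (mulr_gt0 eN0 r0)) ler_pdivrMr ?mulr_gt0//.
apply: (le_trans FB); rewrite /orlicz_integrand -/r.
have div_mul x l : x / (l * r) = x / r / l by rewrite invfM (mulrC l^-1) mulrA.
rewrite !div_mul le_eqVlt; apply/orP; left; apply/eqP; field; exact: lt0r_neq0.
Qed.

Lemma picone_integrand_integrable u v lu lv :
  measurable_fun setT u -> measurable_fun setT v ->
  {ae mu, forall x, comparable u v x} -> 0 < lu -> 0 < lv ->
  (\int[mu \x mu]_z (orlicz_integrand s G u lu z)%:E < +oo)%E ->
  (\int[mu \x mu]_z (orlicz_integrand s G v lv z)%:E < +oo)%E ->
  (mu \x mu)%E.-integrable setT
    (EFin \o picone_integrand s g u (picone_test q Omega u v)).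
Proof.
move=> mfu mfv auv lu0 lv0 iu iv.
have G0 : G 0 = 0 by exact/(nfun_eq0 hG).
have cG (t : R) : 0 < t -> {for t, continuous G}.
  move=> t0; apply: differentiable_continuous; apply/derivable1_diffP.
  exact: (@ex_derive _ _ _ _ _ _ _ (is_derive_Rplus hg t0)).
have cg := derivative_continuous_gt0 hg'.
have oi w lw : measurable_fun setT w -> 0 < lw ->
    (\int[mu \x mu]_z (orlicz_integrand s G w lw z)%:E < +oo)%E ->
    (mu \x mu)%E.-integrable setT (EFin \o orlicz_integrand s G w lw).
  move=> mw lw0 iw; apply/integrableP; split.
    by apply/measurable_EFinP; exact: measurable_orlicz_integrand.
  under eq_integral => z _.
    rewrite /= ger0_norm; last first.
      rewrite divr_ge0 ?exprn_ge0 ?enorm_ge0// nfun_ge0// divr_ge0// mulr_ge0 ?powR_ge0//.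
      exact: ltW.
    over.
  exact: iw.
have [Ku [Kv KB]] := picone_integrand_bound lu0 lv0.
apply: (ae_le_integrable (g := fun z => (Ku%:E * (orlicz_integrand s G u lu z)%:E +
   Kv%:E * (orlicz_integrand s G v lv z)%:E)%E)).
- apply/measurable_EFinP; apply: measurable_picone_integrand => //.
  exact: measurable_picone_test.
- by apply: integrableD => //; apply: integrableZl => //; exact: oi.
- move: (ae_fst mu auv) (ae_snd mu auv); apply: filterS2 => z c1 c2.
  rewrite -!EFinM -EFinD /= lee_fin; apply: le_trans (ler_norm _).
  exact: KB.
Qed.

Lemma picone_integrand_add u v z : comparable u v z.1 -> comparable u v z.2 ->
  let S := picone_integrand s g u (picone_test q Omega u v) z +
           picone_integrand s g v (picone_test q Omega v u) z in
  0 <= S /\ (S = 0 -> v z.1 * u z.2 = u z.1 * v z.2 /\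
    (q < pm -> `|u z.1 - u z.2| = `|v z.1 - v z.2|)).
Proof.
move=> c1 c2; have d1 := picone_comparable_sym c1; have d2 := picone_comparable_sym c2.
(* On the diagonal there is no positive [r], but the integrands vanish and both equality conclusions
   are trivial. *)
have [e0|e0] := eqVneq (enorm (z.1 - z.2)) 0.
  have /eqP := enorm_eq0 e0; rewrite subr_eq0 => /eqP zz.
  rewrite /picone_integrand zz !subrr normr0 !(mul0r, mulr0) addr0.
  by split => // _; rewrite mulrC.
have ep : 0 < enorm (z.1 - z.2) by rewrite lt_def e0 enorm_ge0.
rewrite !picone_integrand_flux// -mulrDl.
have r0 : 0 < enorm (z.1 - z.2) `^ s by exact: powR_gt0.
have k0 : 0 < (enorm (z.1 - z.2) `^ (N%:R + s))^-1 by rewrite invr_gt0 powR_gt0.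
have [u1 v1 _ _ _] := c1; have [u2 v2 _ _ _] := c2.
have [S0 S1 S2] := picone_flux_add_ge0 hG hg hg' hpm hgp q1 qpm r0 u1 u2 v1 v2
  (picone_comparable_eq0 c1) (picone_comparable_eq0 c2).
split; first by rewrite pmulr_lge0.
move=> /eqP; rewrite mulf_eq0 (gt_eqF k0) orbF => /eqP S.
by split; [exact: S1|move=> ?; exact: S2].
Qed.

End picone_form_analysis.

(** * The integrated inequality and its equality cases *)

Theorem lemma2p8 (R : realType) (N : nat) (s : R) (Omega : set 'rV[R]_N)
    (G g g' : R -> R) (pm pp q : R)
    (hN : (1 <= N)%N) (hs : 0 < s < 1)
    (hOmega : lipschitz_bounded_domain Omega)
    (hG : N_function G)
    (hg : derivative_Rplus G g)
    (hg' : derivative_Rplus g g')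
    (hg'_cont : {within `[0, +oo[, continuous g'})
    (hpm : 1 < pm - 1)
    (hgp : forall t : R, 0 < t -> pm - 1 <= t * g' t / g t <= pp - 1)
    (hq : 1 < q <= pm)
    (u v : 'rV[R]_N -> R)
    (hu : orlicz_sobolev0 s G Omega u)
    (hv : orlicz_sobolev0 s G Omega v)
    (hu_gt0 : {ae lebesgue_rV R N, forall x, Omega x -> 0 < u x})
    (hv_gt0 : {ae lebesgue_rV R N, forall x, Omega x -> 0 < v x})
    (huv : Linfty Omega (fun x => u x / v x))
    (hvu : Linfty Omega (fun x => v x / u x)) :
  let I := (picone_form s g u (picone_test q Omega u v) +
            picone_form s g v (picone_test q Omega v u))%E in
  (0 <= I)%E /\
  (I = 0%E ->
    (exists2 c : R, 0 < c &
      {ae lebesgue_rV R N, forall x, Omega x -> u x / v x = c}) /\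
    (q <> pm -> {ae lebesgue_rV R N, forall x, Omega x -> u x = v x})).
Proof.
move=> I.
have [oO _ _ bO _] := hOmega.
have mO : measurable Omega := open_measurable_rV oO.
have nOC := bounded_setC_not_negligible hN bO.
(* A null space would make the complement of [Omega] negligible. *)
have mu0 : (0 < lebesgue_rV R N setT)%E.
  rewrite lt0e measure_ge0 andbT; apply/eqP => muT0; apply: nOC.
  by exists setT; split.
have [[[mu_u _] [lu lu0 iu]] u_out] := hu.
have [[[mu_v _] [lv lv0 iv]] v_out] := hv.
have [s0 _] := andP hs; have [q1 qpm] := andP hq.
have [Mu hMu] := Linfty_ae_bounded mu0 huv.
have [Mv hMv] := Linfty_ae_bounded mu0 hvu.
pose M := Num.max Mu Mv.
have cmp : {ae lebesgue_rV R N, forall x, picone_comparable M Omega u v x}.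
  near=> x.
  have uO : Omega x -> 0 < u x by near: x.
  have vO : Omega x -> 0 < v x by near: x.
  have u0 : ~ Omega x -> u x = 0 by near: x.
  have v0 : ~ Omega x -> v x = 0 by near: x.
  have Mux : Omega x -> `|u x / v x| <= Mu by near: x.
  have Mvx : Omega x -> `|v x / u x| <= Mv by near: x.
  have [Ox|nOx] := pselect (Omega x); last first.
    by split; rewrite ?u0 ?v0 ?mulr0//; split.
  have ux := uO Ox; have vx := vO Ox.
  split => //; [exact: ltW|exact: ltW| | ].
  - rewrite -ler_pdivrMr// (le_trans (ler_norm _))// (le_trans (Mux Ox))//.
    by rewrite le_max lexx.
  - rewrite -ler_pdivrMr// (le_trans (ler_norm _))// (le_trans (Mvx Ox))//.
    by rewrite le_max lexx orbT.
have cmp' : {ae lebesgue_rV R N, forall x, picone_comparable M Omega v u x}.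
  by apply: filterS cmp => x; exact: picone_comparable_sym.
have int1 := picone_integrand_integrable hG hg hg' hpm hgp q1 s0 mO
  mu_u mu_v cmp lu0 lv0 iu iv.
have int2 := picone_integrand_integrable hG hg hg' hpm hgp q1 s0 mO
  mu_v mu_u cmp' lv0 lu0 iv iu.
have IE : I = (\int[lebesgue_rV R N \x lebesgue_rV R N]_z
    ((picone_integrand s g u (picone_test q Omega u v) z)%:E +
     (picone_integrand s g v (picone_test q Omega v u) z)%:E))%E.
  by rewrite (integralD measurableT int1 int2).
pose P (z : 'rV[R]_N * 'rV[R]_N) := v z.1 * u z.2 = u z.1 * v z.2 /\
    (q < pm -> `|u z.1 - u z.2| = `|v z.1 - v z.2|).
have pw : {ae (lebesgue_rV R N \x lebesgue_rV R N)%E, forall z,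
    (0 <= (picone_integrand s g u (picone_test q Omega u v) z)%:E +
          (picone_integrand s g v (picone_test q Omega v u) z)%:E)%E /\
    (((picone_integrand s g u (picone_test q Omega u v) z)%:E +
      (picone_integrand s g v (picone_test q Omega v u) z)%:E = 0)%E -> P z)}.
  move: (ae_fst (lebesgue_rV R N) cmp) (ae_snd (lebesgue_rV R N) cmp).
  apply: filterS2 => z c1 c2.
  have [S0 S1] := picone_integrand_add s hG hg hg' hpm hgp q1 qpm c1 c2.
  by rewrite -EFinD lee_fin; split => // -[]; exact: S1.
have [I0 I1] := ae_ge0_integral
  (measurable_int _ (integrableD measurableT int1 int2)) (filterS (fun z => @proj1 _ _) pw).
rewrite IE; split => // /I1 S0.
(* The identities on pairs become iterated: for almost every [x] they hold for almost every [y], so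
   a single good [x] can be fixed. *)
have {S0}: {ae lebesgue_rV R N, forall x,
    picone_comparable M Omega u v x /\
    {ae lebesgue_rV R N, forall y, picone_comparable M Omega u v y /\ P (x, y)}}.
  have : {ae (lebesgue_rV R N \x lebesgue_rV R N)%E, forall z, P z}.
    by move: pw S0; apply: filterS2 => z [_]; exact.
  move=> /ae_sections; apply: filterS2 (cmp) => x cx Px; split => //.
  by move: cmp Px; apply: filterS2 => y.
move=> aeP; split.
  (* Over a negligible [Omega] any positive constant serves; otherwise [Omega] contains a good base
     point [x], and the constant is [u x / v x]. *)
  have [nO|nO] := pselect ((lebesgue_rV R N).-negligible Omega).
    exists 1 => //; apply: negligibleS nO => x.
    by move=> /not_implyP[].
  have [x Ox [cx aex]] := ae_exists_in nO aeP.
  have [_ _ _ _ [/(_ Ox) ux _]] := cx.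
  have [_ _ _ _ [/(_ Ox) vx _]] := picone_comparable_sym cx.
  exists (u x / v x); first exact: divr_gt0.
  apply: filterS aex => y [/picone_comparable_sym[_ _ _ _ [vy _]] [/= e _]] Oy.
  have {}vy := vy Oy.
  by apply/eqP; rewrite eqr_div ?lt0r_neq0//; apply/eqP; rewrite mulrC e.
move=> qn; have qlt : q < pm by rewrite lt_neqAle qpm andbT; apply/eqP.
apply: filterS aeP => x [[ux vx _ _ _] aex] _.
(* The point [y] may depend on [x]; it only has to lie outside [Omega], where [u y = v y = 0]. *)
have [y nOy [cy [_ /(_ qlt)]]] := ae_exists_in nOC aex.
have [_ _ _ _ [_ /(_ nOy) ->]] := cy.
have [_ _ _ _ [_ /(_ nOy) ->]] := picone_comparable_sym cy.
by rewrite /= !subr0 !ger0_norm.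
Unshelve. all: by end_near. Qed.
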